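(* Let $f_0:\mathbb{R}^d\to\mathbb{R}$ be convex, differentiable, and $L$-smooth for $L>0$, and $f_1:\mathbb{R}^d\to\mathbb{R}$ be convex. Let $\theta_0\in\mathbb{R}^d$ and consider the proximal gradient descent iterates $$\theta_{t+1}=\mathrm{prox}_{\eta_tf_1}\big(\theta_t-\eta_t\nabla f_0(\theta_t)\big)$$ with step sizes $\eta_t\in(0,1/L]$, $t=0,1,2,\dots$. For any reference point $z\in\mathbb{R}^d$, and any iteration $T\ge1$, it holds for $f=f_0+f_1$ that $$f(\theta_T)-f(z)\le\frac1{2\sum_{t=0}^{T-1}\eta_t}\Big(\|\theta_0-z\|_2^2-\|\theta_T-z\|_2^2\Big).$$
   Context: The proximal operator is $\mathrm{prox}_{\eta f_1}(\theta)=\arg\min_{z\in\mathbb{R}^d}\big(\frac12\|\theta-z\|_2^2+\eta f_1(z)\big)$. A differentiable function $f_0$ is $L$-smooth (with respect to $\|\cdot\|_2$) if $\|\nabla f_0(x)-\nabla f_0(y)\|_2\le L\|x-y\|_2$ for all $x,y$. *)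

(* Defs.v *)
From mathcomp Require Import all_boot all_order all_algebra.
From mathcomp Require Import all_classical all_reals all_analysis.
Import numFieldNormedType.Exports.

Set Implicit Arguments.
Unset Strict Implicit.
Unset Printing Implicit Defensive.

Import Order.TTheory GRing.Theory Num.Theory.

Local Open Scope classical_set_scope.
Local Open Scope ring_scope.

(* The library norm `|x| on 'rV[R]_d is the sup norm, so the Euclidean norm is
   defined separately; [differentiable] does not depend on this choice, the
   dimension being finite. *)
Definition norm2 (R : realType) (d : nat) (x : 'rV[R]_d) : R :=
  Num.sqrt (\sum_(i < d) x ord0 i ^+ 2).

(* Vector of partial derivatives: the j-th canonical basis vector is
   [delta_mx ord0 j]. Only meaningful where f is differentiable. *)
Definition gradient (R : realType) (d : nat) (f : 'rV[R]_d -> R)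
    (x : 'rV[R]_d) : 'rV[R]_d :=
  \row_(j < d) 'D_(delta_mx ord0 j) f x.

Definition smooth (R : realType) (d : nat) (L : R) (f : 'rV[R]_d -> R) : Prop :=
  forall x y, norm2 (gradient f x - gradient f y) <= L * norm2 (x - y).

Definition argmin (R : realType) (T : Type) (g : T -> R) : set T :=
  [set z | forall w, g z <= g w].

(* [get A] is an element of A, or an arbitrary vector if A is empty. For f convex
   and 0 < eta the objective is continuous and strongly convex, so its argmin is
   a singleton and [prox] is that unique minimizer. *)
Definition prox (R : realType) (d : nat) (eta : R) (f : 'rV[R]_d -> R)
    (theta : 'rV[R]_d) : 'rV[R]_d :=
  get (argmin (fun z : 'rV[R]_d =>
    2^-1 * norm2 (theta - z) ^+ 2 + eta * f z)).

(* Main.v *)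
Require Import Defs.
From mathcomp Require Import all_boot all_order all_algebra.
From mathcomp Require Import all_classical all_reals all_analysis.
From mathcomp Require Import ring lra.

Import Order.TTheory GRing.Theory Num.Theory.
Import numFieldNormedType.Exports.

(** Fix one step, from x to p = prox (eta f1) (x - eta grad f0 x), and any
    reference point w. Three estimates are added:
    - smoothness bounds f0 p above by its linearization at x plus
      L/2 |p - x|^2 ([smooth_upper_bound]), and eta <= 1/L turns the quadratic
      term into at most |p - x|^2 / (2 eta);
    - convexity bounds f0 w below by the same linearization
      ([convex_gradient_le]);
    - optimality of p gives eta (f1 p - f1 w) <= <x - eta grad f0 x - p, p - w>
      ([prox_variational]).
    The gradient terms cancel, and what is left is the polarization identity
    2 <x - p, p - w> + |p - x|^2 = |x - w|^2 - |p - w|^2, so that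
    2 eta (f p - f w) <= |x - w|^2 - |p - w|^2 ([prox_gradient_step]).
    With w = x this says that f decreases along the iterates; with w = z it
    telescopes, and monotonicity lets f (theta_T) stand for each
    f (theta_(t+1)) in the weighted sum.

    The other half of the work is that the proximal point exists, since
    otherwise [prox] is an arbitrary vector. A convex function on R^d is bounded
    above near every point, hence continuous there and, away from that point,
    bounded below by an affine function of the distance to it. The objective
    defining the prox is therefore continuous, and its quadratic part wins
    outside a large ball, so that a minimum over that compact ball is a global
    one ([prox_argmin]). *)

Set Implicit Arguments.
Unset Strict Implicit.
Unset Printing Implicit Defensive.

Local Open Scope classical_set_scope.
Local Open Scope ring_scope.

(** * Euclidean inner product *)

Definition dot (R : realType) (d : nat) (u v : 'rV[R]_d) : R :=
  (u *m v^T) 0 0.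

Lemma dotDl (R : realType) (d : nat) (u v w : 'rV[R]_d) :
  dot (u + v) w = dot u w + dot v w.
Proof. by rewrite /dot mulmxDl mxE. Qed.

Lemma dotZl (R : realType) (d : nat) (a : R) (u v : 'rV[R]_d) :
  dot (a *: u) v = a * dot u v.
Proof. by rewrite /dot -scalemxAl mxE. Qed.

Lemma dotNl (R : realType) (d : nat) (u v : 'rV[R]_d) :
  dot (- u) v = - dot u v.
Proof. by rewrite -scaleN1r dotZl mulN1r. Qed.

Lemma dotC (R : realType) (d : nat) (u v : 'rV[R]_d) : dot u v = dot v u.
Proof. by rewrite /dot -[in LHS](trmxK u) -trmx_mul mxE. Qed.

Lemma dotDr (R : realType) (d : nat) (u v w : 'rV[R]_d) :
  dot w (u + v) = dot w u + dot w v.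
Proof. by rewrite ![dot w _]dotC dotDl. Qed.

Lemma dotZr (R : realType) (d : nat) (a : R) (u v : 'rV[R]_d) :
  dot v (a *: u) = a * dot v u.
Proof. by rewrite !(dotC v) dotZl. Qed.

Lemma dotNr (R : realType) (d : nat) (u v : 'rV[R]_d) :
  dot v (- u) = - dot v u.
Proof. by rewrite dotC dotNl dotC. Qed.

Definition dot_linear := (dotDl, dotDr, dotZl, dotZr, dotNl, dotNr).

Lemma norm2_sq (R : realType) (d : nat) (u : 'rV[R]_d) :
  norm2 u ^+ 2 = dot u u.
Proof.
rewrite /norm2 sqr_sqrtr; last by apply: sumr_ge0 => i _; exact: sqr_ge0.
by rewrite /dot mxE; apply: eq_bigr => i _; rewrite mxE expr2.
Qed.

Lemma dot_ge0 (R : realType) (d : nat) (u : 'rV[R]_d) : 0 <= dot u u.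
Proof. by rewrite -norm2_sq sqr_ge0. Qed.

(** The form of Cauchy-Schwarz that suffices here: it is the expansion of
    0 <= |u - c v|^2. *)
Lemma dot_le (R : realType) (d : nat) (c : R) (u v : 'rV[R]_d) :
  0 < c -> norm2 u <= c * norm2 v -> dot u v <= c * dot v v.
Proof.
move=> c0 uv.
have := dot_ge0 (u - c *: v).
have : dot u u <= c ^+ 2 * dot v v.
  rewrite -!norm2_sq -exprMn ler_sqr ?nnegrE ?sqrtr_ge0//.
  by rewrite mulr_ge0 ?sqrtr_ge0// ltW.
rewrite !dot_linear (dotC v u) => h1 h2.
rewrite -(ler_pM2l c0); lra.
Qed.

(** The defect term - t (1 - t) |x - y|^2 makes z |-> |a - z|^2 convex. *)
Lemma dot_convex_comb (R : realType) (d : nat) (t : R) (a x y : 'rV[R]_d) :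
  dot (a - (t *: x + (1 - t) *: y)) (a - (t *: x + (1 - t) *: y)) =
  t * dot (a - x) (a - x) + (1 - t) * dot (a - y) (a - y)
  - t * (1 - t) * dot (x - y) (x - y).
Proof.
rewrite !dot_linear (dotC x a) (dotC y a) (dotC y x); ring.
Qed.

(** * Convex functions on R^d *)

(** Replaces the bundled weights in [0, 1] by inequalities on a scalar, which
    linear arithmetic can handle. *)
Lemma convex_functionP (R : realType) (E : lmodType R) (f : E -> R) :
  convex_function [set: E] f <->
  forall (t : R) (x y : E), 0 <= t -> t <= 1 ->
    f (t *: x + (1 - t) *: y) <= t * f x + (1 - t) * f y.
Proof.
split=> [cf t x y t0 t1 | cf t x y _ _].
  by have := cf (Itv01 t0 t1) x y; rewrite !inE => /(_ Logic.I Logic.I).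
by apply: cf; [exact: ge0 | exact: le1].
Qed.

Lemma convex_le_ends (R : realType) (E : lmodType R) (f : E -> R) (a v : E)
    (r s : R) : convex_function [set: E] f -> 0 < r -> `|s| <= r ->
  f (a + s *: v) <= `|f (a + r *: v)| + `|f (a - r *: v)|.
Proof.
move=> /convex_functionP cf r0; rewrite ler_norml => /andP[s1 s2].
pose t := (s + r) / (2 * r).
have t0 : 0 <= t by rewrite /t divr_ge0//; lra.
have t1 : t <= 1 by rewrite /t ler_pdivrMr; lra.
have -> : a + s *: v = t *: (a + r *: v) + (1 - t) *: (a - r *: v).
  rewrite !scalerDr scalerN !scalerA addrACA -scalerDl -scalerBl.
  rewrite [t + _]addrC subrK scale1r; congr (_ + _ *: _).
  by rewrite /t; field; rewrite gt_eqF.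
apply: (le_trans (cf t _ _ t0 t1)); apply: lerD.
  by apply: (le_trans (ler_norm _)); rewrite normrM ger0_norm// ler_piMl.
apply: (le_trans (ler_norm _)).
by rewrite normrM ger0_norm ?ler_piMl//; lra.
Qed.

(** Halving, a + c_i v_i + S = 1/2 (a + 2 c_i v_i) + 1/2 (a + 2 S), splits off
    one direction at the price of doubling the radius; quantifying the bound
    over every radius makes the induction go through, without Jensen's
    inequality over several points. *)
Lemma convex_bounded_comb (R : realType) (E : lmodType R) (f : E -> R)
    (I : Type) (v : I -> E) (a : E) (s : seq I) (r : R) :
  convex_function [set: E] f -> 0 < r ->
  exists M, forall c : I -> R, (forall i, `|c i| <= r) ->
    f (a + \sum_(i <- s) c i *: v i) <= M.
Proof.
move=> cf; elim: s r => [|i s IHs] r r0.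
  by exists (f a) => c _; rewrite big_nil addr0.
have r20 : 0 < 2 * r by rewrite mulr_gt0.
have [M hM] := IHs _ r20.
exists (2^-1 * (`|f (a + (2 * r) *: v i)| + `|f (a - (2 * r) *: v i)|) +
  2^-1 * M) => c hc.
have hc2 j : `|2 * c j| <= 2 * r by rewrite normrM ger0_norm// ler_pM2l.
have -> : a + \sum_(j <- i :: s) c j *: v j =
    2^-1 *: (a + (2 * c i) *: v i) +
    (1 - 2^-1) *: (a + \sum_(j <- s) (2 * c j) *: v j).
  have -> : 1 - 2^-1 = 2^-1 :> R by field.
  rewrite big_cons.
  under [in RHS]eq_bigr do rewrite -scalerA.
  rewrite -scaler_sumr !scalerDr !scalerA addrACA -scalerDl.
  have -> : 2^-1 + 2^-1 = 1 :> R by field.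
  have -> : 2^-1 * (2 * c i) = c i by field.
  by rewrite mulVf ?pnatr_eq0// !scale1r.
move/convex_functionP : (cf) => cfP.
apply: (le_trans (cfP _ _ _ _ _)); [lra|lra|].
have -> : 1 - 2^-1 = 2^-1 :> R by field.
apply: lerD; rewrite ler_pM2l ?invr_gt0//.
  exact: convex_le_ends.
exact: hM.
Qed.

Lemma norm_coord_le (R : realType) (d : nat) (h : 'rV[R]_d) (i : 'I_d) :
  `|h 0 i| <= `|h|.
Proof.
rewrite [leRHS]/Num.Def.normr/= mx_normrE.
by apply/bigmax_geP; right => /=; exists (0, i).
Qed.

(** Finite dimension enters here, through the canonical basis. *)
Lemma convex_locally_bounded (R : realType) (d : nat) (f : 'rV[R]_d -> R)
    (a : 'rV[R]_d) : convex_function [set: 'rV[R]_d] f ->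
  exists2 M, f a <= M & forall h, `|h| <= 1 -> f (a + h) <= M.
Proof.
move=> cf.
have [M hM] := convex_bounded_comb (fun i => delta_mx 0 i : 'rV[R]_d) a
  (index_enum _) cf ltr01.
have {}hM h : `|h| <= 1 -> f (a + h) <= M.
  move=> h1; rewrite {1}(row_sum_delta h); apply: hM => i.
  exact: le_trans (norm_coord_le _ _) h1.
by exists M => //; rewrite -[a]addr0; apply: hM; rewrite normr0.
Qed.

(** The point a lies between a + h and its reflection a - h / t, with weights
    1 / (1 + t) and t / (1 + t). This turns upper bounds on f into lower
    bounds. *)
Lemma convex_reflection (R : realType) (E : lmodType R) (f : E -> R)
    (a h : E) (t : R) : convex_function [set: E] f -> 0 < t ->
  (1 + t) * f a <= f (a + h) + t * f (a - t^-1 *: h).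
Proof.
move=> /convex_functionP cf t0; pose s := (1 + t)^-1.
have s0 : 0 < s by rewrite invr_gt0; lra.
have st : s * (1 + t) = 1 by rewrite mulVf// gt_eqF//; lra.
have lo : f a <= s * f (a + h) + (1 - s) * f (a - t^-1 *: h).
  have {1}-> : a = s *: (a + h) + (1 - s) *: (a - t^-1 *: h).
    rewrite !scalerDr addrACA -scalerDl [s + _]addrC subrK scale1r.
    rewrite scalerN scalerA -scalerBl (_ : s - _ = 0) ?scale0r ?addr0//.
    by rewrite /s; field; rewrite !gt_eqF//; lra.
  by apply: cf => //; rewrite ?ltW //; nra.
have -> : f (a + h) + t * f (a - t^-1 *: h) =
    (1 + t) * (s * f (a + h) + (1 - s) * f (a - t^-1 *: h)).
  by rewrite /s; field; rewrite gt_eqF//; lra.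
by rewrite ler_pM2l//; lra.
Qed.

(** If f <= M on the unit ball around a, the two chords through a in the
    direction of h give |f (a + h) - f a| <= t (M - f a) for |h| <= t <= 1. *)
Lemma convex_continuous (R : realType) (d : nat) (f : 'rV[R]_d -> R) :
  convex_function [set: 'rV[R]_d] f -> continuous f.
Proof.
move=> cf a; have [M faM hM] := convex_locally_bounded a cf.
have /convex_functionP cfP := cf.
have key t h : 0 < t -> t <= 1 -> `|h| <= t ->
    `|f a - f (a + h)| <= t * (M - f a).
  move=> t0 t1 ht.
  have ht1 : `|t^-1 *: h| <= 1.
    by rewrite normrZ gtr0_norm ?invr_gt0// ler_pdivrMl// mulr1.
  have up : f (a + h) <= t * f (a + t^-1 *: h) + (1 - t) * f a.
    have -> : a + h = t *: (a + t^-1 *: h) + (1 - t) *: a.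
      rewrite scalerDr scalerA divff ?gt_eqF// scale1r addrAC -scalerDl.
      by rewrite [t + _]addrC subrK scale1r.
    by apply: cfP => //; lra.
  have h1 : t * f (a + t^-1 *: h) <= t * M by rewrite ler_pM2l// hM.
  have lo := convex_reflection a h cf t0.
  have h2 : t * f (a - t^-1 *: h) <= t * M by rewrite ler_pM2l// hM// normrN.
  rewrite ler_norml; apply/andP; split; lra.
apply/(@cvgrPdist_le _ _ _ _ (nbhs_filter a)) => e e0.
have K0 : 0 < M - f a + 1 by lra.
pose t := Num.min 1 (e / (M - f a + 1)).
have t0 : 0 < t by rewrite lt_min ltr01 divr_gt0.
have t1 : t <= 1 by rewrite ge_min lexx.
have te : t * (M - f a) <= e.
  apply: (@le_trans _ _ (t * (M - f a + 1))); first by rewrite ler_pM2l//; lra.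
  by rewrite -ler_pdivlMr// ge_min lexx orbT.
apply/nbhs_ballP; exists t => //= x.
rewrite -ball_normE/= distrC => /ltW xt; apply: le_trans te.
by rewrite -{1}(subrKC a x); apply: key.
Qed.

(** Convexity at u against the unit vector opposite to h, where f is bounded
    above by some M, gives the slope K = M - f u. *)
Lemma convex_linear_minorant (R : realType) (d : nat) (f : 'rV[R]_d -> R)
    (u : 'rV[R]_d) : convex_function [set: 'rV[R]_d] f ->
  exists2 K, 0 <= K & forall h, 1 <= `|h| -> f u - K * `|h| <= f (u + h).
Proof.
move=> cf; have [M fuM hM] := convex_locally_bounded u cf.
exists (M - f u); first lra.
move=> h h1; have h0 : 0 < `|h| by lra.
have := convex_reflection u h cf h0.
have : `|h| * f (u - `|h|^-1 *: h) <= `|h| * M.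
  rewrite ler_pM2l//; apply: hM.
  by rewrite normrN normrZ normfV normr_id mulVf// gt_eqF.
lra.
Qed.

(** * The proximal point *)

Lemma convex_prox_objective (R : realType) (d : nat) (eta : R)
    (f : 'rV[R]_d -> R) (u : 'rV[R]_d) :
  0 < eta -> convex_function [set: 'rV[R]_d] f ->
  convex_function [set: 'rV[R]_d]
    (fun z : 'rV[R]_d => 2^-1 * norm2 (u - z) ^+ 2 + eta * f z).
Proof.
move=> eta0 /convex_functionP cf; apply/convex_functionP => t x y t0 t1.
rewrite !norm2_sq dot_convex_comb.
have := cf t x y t0 t1; rewrite -(ler_pM2l eta0).
have : 0 <= t * (1 - t) * dot (x - y) (x - y).
  by rewrite !mulr_ge0 ?dot_ge0//; lra.
lra.
Qed.

Lemma norm_le_norm2 (R : realType) (d : nat) (h : 'rV[R]_d) : `|h| <= norm2 h.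
Proof.
rewrite [leLHS]/Num.Def.normr/= mx_normrE.
apply: bigmax_le; first exact: sqrtr_ge0.
move=> [i j] _ /=; rewrite (ord1 i) -sqrtr_sqr ler_sqrt; last first.
  by apply: sumr_ge0 => k _; exact: sqr_ge0.
by rewrite (bigD1 j)//= lerDl sumr_ge0// => k _; exact: sqr_ge0.
Qed.

(** The existence of the proximal point. Outside the ball of radius
    1 + 2 eta K around u, the loss eta K |z - u| allowed by the linear minorant
    is less than the quadratic term, so the objective exceeds its value at u,
    and a minimizer over that compact ball is a minimizer everywhere. *)
Lemma prox_argmin (R : realType) (d : nat) (eta : R) (f : 'rV[R]_d -> R)
    (u w : 'rV[R]_d) :
  0 < eta -> convex_function [set: 'rV[R]_d] f ->
  2^-1 * norm2 (u - prox eta f u) ^+ 2 + eta * f (prox eta f u) <=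
  2^-1 * norm2 (u - w) ^+ 2 + eta * f w.
Proof.
move=> eta0 cf; rewrite /prox.
set phi := fun z : 'rV[R]_d => 2^-1 * norm2 (u - z) ^+ 2 + eta * f z.
suff [p pmin] : exists p, argmin phi p.
  by have /(_ w) := @getPex _ (argmin phi) (ex_intro _ p pmin).
have phic : continuous phi.
  by apply: convex_continuous; exact: convex_prox_objective.
have [K K0 hK] := convex_linear_minorant u cf.
(* The ball is one of the sup norm, the norm for which compactness is available;
   the Euclidean norm dominates it. *)
pose r := 1 + 2 * eta * K.
have r1 : 1 <= r by rewrite lerDl !mulr_ge0// ltW.
pose B : set 'rV[R]_d := closed_ball u r.
have BE z : B z <-> `|z - u| <= r.
  by rewrite /B closed_ballE ?(lt_le_trans ltr01)//= /closed_ball_ /= distrC.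
have cB : compact B.
  apply: bounded_closed_compact; last exact: closed_ball_closed.
  exists (`|u| + r); split; first by rewrite num_real.
  move=> x rx z /BE zr; apply: ltW; apply: le_lt_trans rx.
  rewrite -[z](subrKC u); apply: (le_trans (ler_normD _ _)).
  by rewrite lerD2l.
have Bu : B u by apply/BE; rewrite subrr normr0; lra.
have [|p _ pmin] := @EVT_min_rV R d phi B _ cB (continuous_subspaceT phic).
  by exists u.
exists p => z /=.
have [zr|rz] := leP `|z - u| r.
  by apply: pmin; rewrite inE; apply/BE.
apply: (@le_trans _ _ (phi u)); first by apply: pmin; rewrite inE.
have := hK (z - u); rewrite subrKC => /(_ (ltW (le_lt_trans r1 rz))).
rewrite -(ler_pM2l eta0) => hf.
have h2 : `|z - u| ^+ 2 <= norm2 (u - z) ^+ 2.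
  by rewrite distrC ler_sqr ?nnegrE ?sqrtr_ge0// norm_le_norm2.
have h3 : (1 + 2 * eta * K) * `|z - u| <= `|z - u| ^+ 2.
  by rewrite expr2 ler_pM2r ?ltW//; lra.
rewrite /phi subrr norm2_sq -{1}[0 : 'rV[R]_d](scale0r (0 : 'rV[R]_d)) dotZl.
lra.
Qed.

(** First-order conditions are obtained by letting s tend to 0. *)
Lemma le_of_le_add_mul (R : realType) (a b c : R) :
  (forall s, 0 < s -> s <= 1 -> a <= b + s * c) -> a <= b.
Proof.
move=> h; apply/ler_addgt0Pr => e e0.
pose s := Num.min 1 (e / (`|c| + 1)).
have c0 : 0 < `|c| + 1 by rewrite ltr_wpDl.
have s0 : 0 < s by rewrite lt_min ltr01 divr_gt0.
apply: (le_trans (h s s0 _)); first by rewrite ge_min lexx.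
rewrite lerD2l (@le_trans _ _ (s * (`|c| + 1)))//.
  by rewrite ler_pM2l// ler_wpDr// ler_norm.
by rewrite -ler_pdivlMr// ge_min lexx orbT.
Qed.

(** First-order optimality: comparing p with s w + (1 - s) p, dividing by s and
    letting s tend to 0 expresses that (u - p) / eta is a subgradient of f
    at p. *)
Lemma prox_variational (R : realType) (d : nat) (eta : R) (f : 'rV[R]_d -> R)
    (u w : 'rV[R]_d) (p := prox eta f u) :
  0 < eta -> convex_function [set: 'rV[R]_d] f ->
  eta * (f p - f w) <= dot (u - p) (p - w).
Proof.
move=> eta0 cf.
apply: (@le_of_le_add_mul _ _ _ (2^-1 * dot (p - w) (p - w))) => s s0 s1.
have := prox_argmin u (s *: w + (1 - s) *: p) eta0 cf.
move/convex_functionP : cf => /(_ s w p (ltW s0) s1).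
rewrite -(ler_pM2l eta0) -/p !norm2_sq.
have -> : u - (s *: w + (1 - s) *: p) = (u - p) + s *: (p - w).
  by apply/rowP => i; rewrite !mxE; ring.
move: (u - p) (p - w) => a b; rewrite !dot_linear (dotC b a) => h1 h2.
rewrite -(ler_pM2l s0); lra.
Qed.

(** * First-order bounds on a differentiable function *)

Lemma gradientE (R : realType) (d : nat) (f : 'rV[R]_d -> R)
    (x v : 'rV[R]_d) :
  differentiable f x -> 'D_v f x = dot (gradient f x) v.
Proof.
move=> df; rewrite deriveE// [in LHS](row_sum_delta v) linear_sum.
rewrite /dot mxE; apply: eq_bigr => i _.
by rewrite linearZ /= !mxE deriveE// mulrC.
Qed.

(** The difference quotients of f at x in the direction y - x are at most
    f y - f x for every step in (0, 1], and so is their limit. *)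
Lemma convex_gradient_le (R : realType) (d : nat) (f : 'rV[R]_d -> R)
    (x y : 'rV[R]_d) :
  convex_function [set: 'rV[R]_d] f -> differentiable f x ->
  f x + dot (gradient f x) (y - x) <= f y.
Proof.
move=> /convex_functionP cf df; rewrite -gradientE// -lerBrDl.
have dv : derivable f x (y - x) by exact: diff_derivable.
have := @cvg_dnbhs_at_right _ _ _ _ _ dv.
move=> /cvgr_to_le; apply.
near=> h.
have h0 : 0 < h by near: h; exact: nbhs_right_gt.
have h1 : h <= 1 by near: h; exact: nbhs_right_le.
rewrite /= [_ *: _]mulrC ler_pdivrMr//.
have -> : h *: (y - x) + x = h *: y + (1 - h) *: x.
  by rewrite scalerBr scalerBl scale1r -addrA [- _ + x]addrC.
have := cf h y x (ltW h0) h1; lra.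
Unshelve. all: by end_near. Qed.

Lemma is_derive_along_line (R : realType) (d : nat) (f : 'rV[R]_d -> R)
    (x v : 'rV[R]_d) (s : R) :
  differentiable f (x + s *: v) ->
  is_derive s (1 : R) (fun r : R => f (x + r *: v) : R)
    (dot (gradient f (x + s *: v)) v).
Proof.
move=> df.
have [dv vE] := derivableP (@diff_derivable _ _ _ _ _ v df).
have E : (fun h : R => h^-1 *: (((fun r : R => f (x + r *: v)) \o shift s)
      (h *: (1 : R)) - f (x + s *: v))) =
   (fun h : R => h^-1 *: ((f \o shift (x + s *: v)) (h *: v) - f (x + s *: v))).
  apply/funext => h /=; congr (_ *: (f _ - _)).
  by rewrite [h *: 1]mulr1 scalerDl addrCA.
split; first by rewrite /derivable E.
by rewrite -gradientE// /derive E.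
Qed.

(** The derivative of s |-> f (x + s v) exceeds its value at 0 by at most
    L s |v|^2. Subtracting the primitive L/2 s^2 |v|^2 of this excess before
    applying the mean value theorem keeps the constant 1/2, which the mean value
    theorem for s |-> f (x + s v) itself would lose. *)
Lemma smooth_upper_bound (R : realType) (d : nat) (L : R)
    (f : 'rV[R]_d -> R) (x v : 'rV[R]_d) :
  0 < L -> (forall x, differentiable f x) -> smooth L f ->
  f (x + v) <= f x + dot (gradient f x) v + L / 2 * dot v v.
Proof.
move=> L0 df Lf; set q := dot v v.
pose psi (s : R) : R := f (x + s *: v) - L / 2 * q * s ^+ 2.
pose dpsi (s : R) : R := dot (gradient f (x + s *: v)) v - L * q * s.
have dpsiE (s : R) : is_derive s 1 psi (dpsi s).
  have h1 := is_derive_along_line (df (x + s *: v)).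
  apply: is_derive_eq.
  by rewrite /dpsi; congr (_ - _); rewrite /GRing.scale /=; field.
have psi_cont : {within `[0, 1], continuous psi}.
  by apply: derivable_within_continuous => s _; apply: ex_derive.
have [c c01] := @MVT_segment R psi dpsi 0 1 ler01 (fun s _ => dpsiE s) psi_cont.
rewrite /psi /dpsi scale0r addr0 scale1r expr0n expr1n /= subr0.
have : dot (gradient f (x + c *: v)) v <= dot (gradient f x) v + L * q * c.
  have /andP[c0 c1] : 0 <= c <= 1 by move: c01; rewrite in_itv.
  have [->|cn0] := eqVneq c 0; first by rewrite scale0r addr0; lra.
  have {}c0 : 0 < c by rewrite lt_neqAle eq_sym cn0.
  have := Lf (x + c *: v) x; rewrite addrAC subrr add0r => /(dot_le L0).
  rewrite !dot_linear -/q => h.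
  rewrite -(ler_pM2l c0); lra.
lra.
Qed.

(** * Proximal gradient descent *)

(** The choice w = x gives monotone decrease, a fixed w a telescoping sum. *)
Lemma prox_gradient_step (R : realType) (d : nat) (f0 f1 : 'rV[R]_d -> R)
    (L eta : R) (x w : 'rV[R]_d)
    (p := prox eta f1 (x - eta *: gradient f0 x)) :
  0 < L -> convex_function [set: 'rV[R]_d] f0 ->
  (forall x, differentiable f0 x) -> smooth L f0 ->
  convex_function [set: 'rV[R]_d] f1 -> 0 < eta <= L^-1 ->
  2 * eta * ((f0 p + f1 p) - (f0 w + f1 w)) <=
    norm2 (x - w) ^+ 2 - norm2 (p - w) ^+ 2.
Proof.
move=> L0 cf0 df0 Lf0 cf1 /andP[eta0 etaL].
have h1 := prox_variational (x - eta *: gradient f0 x) w eta0 cf1.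
have := convex_gradient_le w cf0 (df0 x).
have := smooth_upper_bound x (p - x) L0 df0 Lf0; rewrite subrKC.
rewrite -(ler_pM2l eta0) => h2; rewrite -(ler_pM2l eta0) => h3.
have h4 : eta * L * dot (p - x) (p - x) <= dot (p - x) (p - x).
  rewrite -[leRHS]mul1r ler_wpM2r ?dot_ge0//.
  by rewrite -ler_pdivlMr// mul1r.
move: h1 h2 h3 h4; rewrite -/p !norm2_sq !dot_linear.
rewrite (dotC w x) (dotC p x) (dotC w p); lra.
Qed.

Theorem theorem7 (R : realType) (d : nat) (f0 f1 : 'rV[R]_d -> R) (L : R)
    (L_gt0 : 0 < L)
    (f0_convex : convex_function [set: 'rV[R]_d] f0)
    (f0_differentiable : forall x : 'rV[R]_d, differentiable f0 x)
    (f0_smooth : smooth L f0)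
    (f1_convex : convex_function [set: 'rV[R]_d] f1)
    (theta0 : 'rV[R]_d) (eta : nat -> R) (theta : nat -> 'rV[R]_d)
    (eta_itv : forall t : nat, 0 < eta t <= L^-1)
    (theta_init : theta 0%N = theta0)
    (theta_step : forall t : nat,
      theta t.+1 = prox (eta t) f1 (theta t - eta t *: gradient f0 (theta t)))
    (z : 'rV[R]_d) (T : nat) (T_ge1 : (1 <= T)%N) :
  let f := fun x : 'rV[R]_d => f0 x + f1 x in
  f (theta T) - f z <=
    1 / (2 * \sum_(0 <= t < T) eta t) *
    (norm2 (theta0 - z) ^+ 2 - norm2 (theta T - z) ^+ 2).
Proof.
cbv zeta; set f := fun x : 'rV[R]_d => f0 x + f1 x.
have eta_gt0 t : 0 < eta t by case/andP: (eta_itv t).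
have step t w : 2 * eta t * (f (theta t.+1) - f w) <=
    norm2 (theta t - w) ^+ 2 - norm2 (theta t.+1 - w) ^+ 2.
  by rewrite theta_step; apply: (@prox_gradient_step R d f0 f1 L (eta t)).
have descent t : f (theta t.+1) <= f (theta t).
  have eta2_gt0 : 0 < 2 * eta t by rewrite mulr_gt0.
  rewrite -subr_le0 -(pmulr_rle0 _ eta2_gt0).
  apply: (le_trans (step t (theta t))).
  by rewrite subrr !norm2_sq /dot mul0mx mxE sub0r oppr_le0 dot_ge0.
have S_ge0 n : 0 <= \sum_(0 <= t < n) eta t.
  by apply: sumr_ge0 => t _; rewrite ltW.
(* By monotonicity f (theta n) may be replaced by f (theta n.+1) in the part of
   the sum already accumulated, so the bound is preserved by each step. *)
have telescope n : 2 * (\sum_(0 <= t < n) eta t) * (f (theta n) - f z) <=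
    norm2 (theta0 - z) ^+ 2 - norm2 (theta n - z) ^+ 2.
  elim: n => [|n IHn]; first by rewrite big_nil mulr0 mul0r theta_init subrr.
  rewrite big_nat_recr//=.
  have := step n z.
  have : (\sum_(0 <= t < n) eta t) * f (theta n.+1) <=
      (\sum_(0 <= t < n) eta t) * f (theta n) by rewrite ler_wpM2l.
  lra.
have S_gt0 : 0 < 2 * \sum_(0 <= t < T) eta t.
  by rewrite mulr_gt0// -(prednK T_ge1) big_nat_recr//= ltr_wpDl.
by rewrite mul1r mulrC ler_pdivlMr// mulrC.
Qed.
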